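(* Let $n\ge 1$ and let $\varphi \in \widehat{\mathrm{Diff}}(\mathbb{R}^n,0)$ be a real formal diffeomorphism. Suppose that $\varphi = \exp(\hat X)$ for some formal vector field $\hat X \in \hat{\mathcal X}(\mathbb{C}^n,0)$ whose linear part $j^1\hat X$ is real, i.e. $j^1 \hat X \in \mathcal X(\mathbb{R}^n,0)$. Then there exists a real formal vector field $\hat Y \in \hat{\mathcal X}(\mathbb{R}^n,0)$ such that $\varphi = \exp(\hat Y)$ and $j^1 \hat Y = j^1 \hat X$.
   Context: Let $\mathfrak m$ be the maximal ideal of $\mathbb{C}[[z_1,\dots,z_n]]$. $\hat{\mathcal X}(\mathbb{C}^n,0)$ is the set of formal (singular) vector fields $X=\sum_{j=1}^n a_j\,\partial/\partial z_j$ with $a_j\in\mathfrak m$, viewed as derivations. $X$ is real, $X\in\hat{\mathcal X}(\mathbb{R}^n,0)$, if all coefficients of the power series $a_1,\dots,a_n$ are real. $\mathcal X(\mathbb{R}^n,0)$ is the subset of real formal vector fields whose coefficients $a_j$ are convergent (germs of real analytic vector fields singular at $0$). A formal diffeomorphism of $(\mathbb{C}^n,0)$ is a tuple $\varphi=(\varphi_1,\dots,\varphi_n)$ with $\varphi_j\in\mathfrak m$ and invertible linear part; $\widehat{\mathrm{Diff}}(\mathbb{R}^n,0)$ is the set of those for which all $\varphi_j$ have real coefficients. For $X\in\hat{\mathcal X}(\mathbb{C}^n,0)$, $\exp(X)$ is the formal diffeomorphism $\left(\sum_{j\ge0}\frac{X^{\circ j}(z_1)}{j!},\dots,\sum_{j\ge0}\frac{X^{\circ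 j}(z_n)}{j!}\right)$, where $X^{\circ 0}(g)=g$ and $X^{\circ(j+1)}(g)=X(X^{\circ j}(g))$ (the formal time-one flow of $X$). $j^1$ denotes the first jet (linear part). *)

(* Defs.v *)
From mathcomp Require Import all_boot all_order all_algebra.
From mathcomp Require Import complex.
From mathcomp Require Import all_classical all_reals all_analysis.
(* the notations of mpoly clash with those of mathcomp-analysis *)
From mathcomp Require Import -(notations) mpoly.

Set Implicit Arguments.
Unset Strict Implicit.
Unset Printing Implicit Defensive.

Import Order.TTheory GRing.Theory Num.Theory.
Import numFieldNormedType.Exports.

Local Open Scope classical_set_scope.
Local Open Scope ring_scope.

Section FormalPowerSeries.
Variables (R : realType) (n : nat).
Local Notation C := R[i].

(* C[[z_1, .., z_n]]: g m is the coefficient in g of the monomial z^m *)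
Definition fps := multinom n -> C.

Implicit Types g h : fps.

Definition fps_coord (i : 'I_n) : fps := fun m => (m == mnm1 i)%:R.

(* Both factors of a decomposition of m have degree at most mdeg m, so the sum
   runs over all of them; compare mcoeffM for polynomials. *)
Definition fps_mul g h : fps := fun m =>
  \sum_(k : bmultinom n (mdeg m).+1 * bmultinom n (mdeg m).+1
         | m == mnm_add k.1 k.2)
    g k.1 * h k.2.

Definition fps_deriv (j : 'I_n) g : fps := fun m =>
  g (mnm_add m (mnm1 j)) *+ (m j).+1.

Definition in_maximal_ideal g : Prop := g mnm0 = 0.

Definition real_fps g : Prop := forall m, g m \is Num.real.

(* absolute convergence on a polydisc centred at 0 *)
Definition convergent_fps g : Prop :=
  exists2 r : R, 0 < r &
    forall z : 'I_n -> C, (forall i, `|z i| < r%:C%C) ->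
      summable [set: multinom n]
        (fun m => (complex.Re `|g m * \prod_i z i ^+ m i|)%:E).

End FormalPowerSeries.

Section FormalVectorFields.
Variables (R : realType) (n : nat).

(* A tuple of n power series: the components of a formal map, or the
   coefficients a_j of the vector field \sum_j a_j d/dz_j. *)
Definition fps_tuple := 'I_n -> fps R n.

Implicit Types X phi : fps_tuple.

Definition jet1 X : fps_tuple := fun i m =>
  if (mdeg m <= 1)%N then X i m else 0.

Definition linear_matrix phi : 'M[R[i]]_n := \matrix_(i, j) phi i (mnm1 j).

Definition formal_vector_field X : Prop := forall j, in_maximal_ideal (X j).

Definition real_formal_vector_field X : Prop :=
  formal_vector_field X /\ forall j, real_fps (X j).

Definition real_analytic_vector_field X : Prop :=
  real_formal_vector_field X /\ forall j, convergent_fps (X j).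

Definition formal_diffeo phi : Prop :=
  (forall i, in_maximal_ideal (phi i)) /\ linear_matrix phi \in unitmx.

Definition real_formal_diffeo phi : Prop :=
  formal_diffeo phi /\ forall i, real_fps (phi i).

Definition vf_apply X (g : fps R n) : fps R n := fun m =>
  \sum_j fps_mul (X j) (fps_deriv j g) m.

(* When X is singular at 0, it acts on the finite-dimensional space of k-jets
   for every k, so that each of these series of complex numbers converges.  In
   general it does not converge in the (z_1, .., z_n)-adic topology. *)
Definition vf_exp X : fps_tuple := fun i m =>
  limn (series (fun j => (j`!%:R)^-1 * iter j (vf_apply X) (fps_coord R i) m
                         : R[i]^o)).

End FormalVectorFields.

(* Main.v *)
(** The complex conjugate of X is another logarithm of phi with the same real
    linear part, so suppose X and its conjugate X' agree up to degree k and let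
    V = X - X'.  Both fields commute with phi, hence exp(ad X) V = V, so that
    W = int_0^1 s exp(s ad X) V ds also commutes with phi and satisfies
    [X, W] = V - int_0^1 exp(s ad X) V ds.  The last integral vanishes in degree
    k + 1, because int_0^1 exp(sX) V exp(-sX') ds = exp(X) exp(-X') - 1 = 0.
    Therefore exp(W/2) conjugates X into a logarithm of phi that equals
    X - V/2, the real part of X, in degree k + 1.  Iterate and let k grow. *)
Require Import Defs.
From mathcomp Require Import all_boot all_order all_algebra.
From mathcomp Require Import complex ring zify.
From mathcomp Require Import all_classical all_reals all_analysis.
From mathcomp Require Import -(notations) mpoly.

Set Implicit Arguments.
Unset Strict Implicit.
Unset Printing Implicit Defensive.

Import Order.TTheory GRing.Theory Num.Theory.
Import numFieldNormedType.Exports.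

Local Open Scope classical_set_scope.
Local Open Scope ring_scope.

(** * Sums of exponential type *)

Section ExponentialSums.
Variable R : realType.
Local Notation C := R[i].
Implicit Types u v : nat -> C.

(** The weight s in [W] comes from integration by parts: the derivative of s exp(s ad X) V is exp(s
    ad X) V + s [X, exp(s ad X) V], so the only obstruction to [X, W] = V is the mean of exp(s ad X)
    V over [0, 1]. Replacing X by X' on the right of that mean costs terms containing V twice. These
    have degree at least 2k + 1, beyond k + 1 once k >= 1, and k = 1 is available at the start
    because the linear part is real. No integral is formed: s^j and s^(j+1) integrate to 1/(j+1) and
    1/(j+2), so each integral becomes a series with these weights, studied coefficient by
    coefficient. Convergence holds since a singular field never lowers the order of a series and
    thus acts on jets as a finite matrix. *)

Definition expsum_term u (j : nat) : C := (j`!%:R)^-1 * u j.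

Definition expsum_partial u (N : nat) : C := \sum_(0 <= j < N) expsum_term u j.

Definition expsum u : C := limn (expsum_partial u : nat -> C^o).

(** This growth makes u_j / j! dominated by an exponential series; it survives sums, shifts and
    [binomial_conv], and holds along the orbits of a matrix. [K] and [r] are complex only to be
    compared with norms: [0 <=] makes them real. *)
Definition geometric_growth u : Prop :=
  exists K r : C, [/\ 0 <= K, 0 <= r & forall j, `|u j| <= K * r ^+ j].

(** The Cauchy product of the series of u_i / i! and v_j / j!, with the factorials absorbed into the
    binomial coefficient. *)
Definition binomial_conv u v (n : nat) : C :=
  \sum_(i < n.+1) 'C(n, i)%:R * (u i * v (n - i)%N).

Lemma cvg_complex (s : nat -> C) (a b : R) :
  (fun N => complex.Re (s N)) @ \oo --> a -> (fun N => complex.Im (s N)) @ \oo --> b ->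
  (s : nat -> C^o) @ \oo --> (Complex a b : C^o).
Proof.
move=> sa sb; apply/cvgrPdist_le => e e0.
have er : e = (complex.Re e)%:C%C by rewrite RRe_real // ger0_real // ltW.
have e'0 : 0 < complex.Re e / 2.
  by rewrite divr_gt0 //; move: e0; rewrite er ltcR.
move/cvgrPdist_le : sa => /(_ _ e'0) sa; move/cvgrPdist_le : sb => /(_ _ e'0) sb.
near=> N.
have -> : (Complex a b : C^o) - s N =
    (a - complex.Re (s N))%:C%C + 'i%C * (b - complex.Im (s N))%:C%C.
  by case: (s N) => x y /=; apply/eqP; rewrite eq_complex /=; apply/andP; split; apply/eqP; ring.
apply: (le_trans (ler_normD _ _)).
rewrite normrM !normc_def /= !expr0n /= !addr0 add0r expr1n sqrtr1 mul1r !sqrtr_sqr.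
rewrite er -rmorphD lecR (splitr (complex.Re e)).
by apply: lerD; near: N.
Unshelve. all: by end_near. Qed.

Lemma cvg_complexP (f : nat -> C) (l : C) :
  (f : nat -> C^o) @ \oo --> (l : C^o) <->
  forall e : C, 0 < e -> \forall N \near \oo, `|f N - l| <= e.
Proof.
split=> [/cvgrPdist_le fl e e0|fl].
  by have := fl e e0; apply: filterS => N; rewrite distrC.
by apply/cvgrPdist_le => e e0; have := fl e e0; apply: filterS => N; rewrite distrC.
Qed.

Lemma cvg_complexB (f g : nat -> C) (a b : C) :
  (f : nat -> C^o) @ \oo --> (a : C^o) -> (g : nat -> C^o) @ \oo --> (b : C^o) ->
  ((fun N => f N - g N) : nat -> C^o) @ \oo --> (a - b : C^o).
Proof. by move=> fa gb; apply: cvgB; [exact: fa|exact: gb]. Qed.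

Lemma expsum_cvg u : geometric_growth u -> cvgn (expsum_partial u : nat -> C^o).
Proof.
move=> [K [r [K0 r0 ur]]].
have Kr : K = (complex.Re K)%:C%C by rewrite RRe_real // ger0_real.
have rr : r = (complex.Re r)%:C%C by rewrite RRe_real // ger0_real.
(* [f] will be the real part, then the imaginary part: both are additive and bounded by the
   modulus. *)
have bd (f : C -> R) : (forall x y, f (x + y) = f x + f y) -> f 0 = 0 ->
    (forall z, `|f z| <= ComplexField.Normc.normc z) ->
    cvgn (fun N => f (expsum_partial u N)).
  move=> fD f0 fn.
  have -> : (fun N => f (expsum_partial u N)) = series (f \o expsum_term u).
    apply/funext => N; rewrite /series /expsum_partial /=.
    by apply: (big_morph f fD f0).
  apply: normed_cvg; apply: (@series_le_cvg _ _
    (complex.Re K *: (exp_coeff (complex.Re r)))).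
  - by move=> j /=.
  - move=> j; rewrite /= mulr_ge0 //; first by rewrite -lecR -Kr.
    by apply: exp_coeff_ge0; rewrite -lecR -rr.
  - move=> j /=; apply: (le_trans (fn _)).
    rewrite -lecR -[(ComplexField.Normc.normc _)%:C%C]/(`|expsum_term u j|) normrM.
    rewrite ger0_norm ?invr_ge0 ?ler0n //.
    rewrite (_ : (_ *: _)%R%:C%C = (j`!%:R)^-1 * (K * r ^+ j)).
      by rewrite ler_wpM2l // invr_ge0 ler0n.
    rewrite /= /exp_coeff /= [in RHS]Kr [in RHS]rr /GRing.scale /=.
    rewrite !rmorphM /= rmorphXn /= fmorphV rmorph_nat; ring.
  - exact/is_cvg_seriesZ/is_cvg_series_exp_coeff.
apply/cvg_ex; exists (Complex (limn (fun N => complex.Re (expsum_partial u N)))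
  (limn (fun N => complex.Im (expsum_partial u N)))).
apply: cvg_complex.
- apply: (bd (@complex.Re R)) => [[? ?] [? ?]//|//|[a b] /=].
  rewrite -sqrtr_sqr ler_wsqrtr // lerDl sqr_ge0 //.
- apply: (bd (@complex.Im R)) => [[? ?] [? ?]//|//|[a b] /=].
  rewrite -sqrtr_sqr ler_wsqrtr // lerDr sqr_ge0 //.
Qed.

Lemma expsumP u : geometric_growth u -> (expsum_partial u : nat -> C^o) @ \oo --> (expsum u : C^o).
Proof. exact: expsum_cvg. Qed.

Lemma expsum_unique u (l : C) : (expsum_partial u : nat -> C^o) @ \oo --> (l : C^o) -> expsum u = l.
Proof. by move=> h; apply: (cvg_lim _ h); exact: norm_hausdorff. Qed.

Lemma expsum0 : expsum (fun=> 0) = 0.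
Proof.
apply: expsum_unique; rewrite (_ : expsum_partial _ = fun=> 0); first exact: cvg_cst.
by apply/funext => N; rewrite /expsum_partial /= big1 // => j _; rewrite /expsum_term mulr0.
Qed.

Lemma geometric_growth0 : geometric_growth (fun=> 0).
Proof. by exists 0, 0; split=> // j; rewrite normr0 mul0r. Qed.

Lemma geometric_growthZ a u : geometric_growth u -> geometric_growth (fun j => a * u j).
Proof.
move=> [K [r [K0 r0 ur]]]; exists (`|a| * K), r; split=> //; first by rewrite mulr_ge0.
by move=> j; rewrite normrM -mulrA ler_wpM2l.
Qed.

Lemma expsumZ a u : geometric_growth u -> expsum (fun j => a * u j) = a * expsum u.
Proof.
move=> gu; apply: expsum_unique.
rewrite (_ : expsum_partial _ = fun N => a * expsum_partial u N).
  by apply: (@cvgZl_tmp _ _ _ _ _ a); exact: expsumP.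
apply/funext => N; rewrite /expsum_partial /= mulr_sumr; apply: eq_bigr => j _.
by rewrite /expsum_term mulrCA.
Qed.

Lemma geometric_growthD u v : geometric_growth u -> geometric_growth v ->
  geometric_growth (fun j => u j + v j).
Proof.
move=> [K [r [K0 r0 ur]]] [L [s [L0 s0 vs]]]; exists (K + L), (r + s).
split; rewrite ?addr_ge0 // => j; apply: (le_trans (ler_normD _ _)).
rewrite mulrDl lerD //.
- apply: (le_trans (ur j)); rewrite ler_wpM2l //.
  by rewrite lerXn2r ?nnegrE ?addr_ge0 // lerDl.
- apply: (le_trans (vs j)); rewrite ler_wpM2l //.
  by rewrite lerXn2r ?nnegrE ?addr_ge0 // lerDr.
Qed.

Lemma expsumD u v : geometric_growth u -> geometric_growth v ->
  expsum (fun j => u j + v j) = expsum u + expsum v.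
Proof.
move=> gu gv; apply: expsum_unique.
rewrite (_ : expsum_partial _ =
    fun N => expsum_partial u N + expsum_partial v N).
  by apply: cvgD; exact: expsumP.
apply/funext => N; rewrite /expsum_partial /= -big_split; apply: eq_bigr => j _ /=.
by rewrite /expsum_term mulrDr.
Qed.

Lemma expsumB u v : geometric_growth u -> geometric_growth v ->
  expsum (fun j => u j - v j) = expsum u - expsum v.
Proof.
move=> gu gv; rewrite -[in RHS]mulN1r -expsumZ // -expsumD //; last first.
  exact: geometric_growthZ.
by congr expsum; apply/funext => j; rewrite mulN1r.
Qed.

Lemma geometric_growth_sum (I : Type) (s : seq I) (P : pred I) (u : I -> nat -> C) :
  (forall i, geometric_growth (u i)) ->
  geometric_growth (fun j => \sum_(i <- s | P i) u i j).
Proof.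
move=> gu; elim: s => [|i s IH].
  rewrite (_ : (fun _ => _) = fun=> 0); first exact: geometric_growth0.
  by apply/funext => j; rewrite big_nil.
rewrite (_ : (fun _ => _) = fun j => (if P i then u i j else 0)
    + \sum_(i <- s | P i) u i j).
  apply: geometric_growthD IH; case: (P i) => //; exact: geometric_growth0.
by apply/funext => j; rewrite big_cons; case: (P i); rewrite ?add0r.
Qed.

Lemma expsum_sum (I : Type) (s : seq I) (P : pred I) (u : I -> nat -> C) :
  (forall i, geometric_growth (u i)) ->
  expsum (fun j => \sum_(i <- s | P i) u i j) = \sum_(i <- s | P i) expsum (u i).
Proof.
move=> gu; elim: s => [|i s IH].
  rewrite big_nil (_ : (fun _ => _) = fun=> 0) ?expsum0 //.
  by apply/funext => j; rewrite big_nil.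
rewrite big_cons; case: ifP => Pi.
- rewrite -IH -expsumD //; last exact: geometric_growth_sum.
  by congr expsum; apply/funext => j; rewrite big_cons Pi.
- by rewrite -IH; congr expsum; apply/funext => j; rewrite big_cons Pi.
Qed.

Lemma geometric_growth_le u v : geometric_growth u ->
  (forall j, `|v j| <= `|u j|) -> geometric_growth v.
Proof.
move=> [K [r [K0 r0 ur]]] vu; exists K, r; split=> // j.
exact: le_trans (vu j) (ur j).
Qed.

Lemma geometric_growthS u : geometric_growth u -> geometric_growth (fun j => u j.+1).
Proof.
move=> [K [r [K0 r0 ur]]]; exists (K * r), r; split=> //; first by rewrite mulr_ge0.
by move=> j; rewrite -mulrA -exprS.
Qed.

Lemma geometric_growth_shift (u : nat -> C) :
  geometric_growth (fun j => u j.+1) -> geometric_growth u.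
Proof.
(* With a ratio of at least 1, raising the exponent from j to j + 1 cannot decrease the bound. *)
move=> [K [r [K0 r0 ur]]]; exists (K + `|u 0%N|), (r + 1).
have r1 : 0 <= r + 1 by rewrite addr_ge0.
split=> //; first by rewrite addr_ge0.
case=> [|j]; first by rewrite expr0 mulr1 lerDr.
apply: (le_trans (ur j)); apply: ler_pM; rewrite ?exprn_ge0 //.
  by rewrite lerDl.
have h : r ^+ j <= (r + 1) ^+ j by rewrite lerXn2r ?nnegrE // lerDl.
apply: (le_trans h); rewrite exprS ler_peMl ?exprn_ge0 // lerDr //.
Qed.

Lemma geometric_growth_div (a : nat) u : geometric_growth u ->
  geometric_growth (fun j => u j / (j + a).+1%:R).
Proof.
move=> gu; apply: geometric_growth_le gu _ => j.
rewrite normrM ler_piMr // ger0_norm ?invr_ge0 ?ler0n //.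
by rewrite invf_le1 ?ltr0n // ler1n.
Qed.

(** For u_j = A^j a this is exp(A) a = a + the integral over [0, 1] of A exp(sA) a: since (j+1)! =
    (j+1) j!, division by j + 1 is integration in s. It also serves to split off leading terms. *)
Lemma expsum_recl u : geometric_growth u ->
  expsum u = u 0%N + expsum (fun j => u j.+1 / j.+1%:R).
Proof.
move=> gu.
have gs : geometric_growth (fun j => u j.+1 / j.+1%:R).
  apply: geometric_growth_le (geometric_growth_div 0 (geometric_growthS gu)) _ => j.
  by rewrite addn0.
apply: expsum_unique; rewrite -cvg_shiftS.
rewrite (_ : (fun N => expsum_partial u N.+1) = fun N => u 0%N +
    expsum_partial (fun j => u j.+1 / j.+1%:R) N).
  by apply: cvgD; [exact: cvg_cst|exact: expsumP].
apply/funext => N; rewrite /expsum_partial /= big_nat_recl //.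
congr +%R; first by rewrite /expsum_term fact0 invr1 mul1r.
apply: eq_bigr => j _.
by rewrite /expsum_term factS natrM invfM; ring.
Qed.

Lemma expsum_single u : (forall j, u j.+1 = 0) -> expsum u = u 0%N.
Proof.
move=> u0; rewrite expsum_recl; last first.
  apply: geometric_growth_shift; rewrite (_ : (fun _ => _) = fun=> 0).
    exact: geometric_growth0.
  by apply/funext.
rewrite (_ : (fun _ => _) = fun=> 0) ?expsum0 ?addr0 //.
by apply/funext => j; rewrite u0 mul0r.
Qed.

Lemma expsum_conj u : geometric_growth u ->
  expsum (fun j => (u j)^*%C) = (expsum u)^*%C.
Proof.
move=> gu; apply: expsum_unique.
rewrite (_ : expsum_partial _ = fun N => (expsum_partial u N)^*%C).
  have nc (z : C) : `|z^*%C| = `|z| by rewrite !normc_def; case: z => a b /=; rewrite sqrrN.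
  apply/cvgrPdist_le => e e0.
  move/cvgrPdist_le : (expsumP gu) => /(_ _ e0); apply: filterS => N /= h.
  by rewrite -rmorphB nc.
apply/funext => N; rewrite /expsum_partial /= rmorph_sum; apply: eq_bigr => j _.
by rewrite /expsum_term rmorphM /= fmorphV rmorph_nat.
Qed.

(** * Products of exponential sums *)

Lemma geometric_growth_conv u v : geometric_growth u -> geometric_growth v ->
  geometric_growth (binomial_conv u v).
Proof.
move=> [K [r [K0 r0 ur]]] [L [s [L0 s0 vs]]]; exists (K * L), (s + r).
split; rewrite ?mulr_ge0 ?addr_ge0 // => j.
rewrite exprDn mulr_sumr; apply: (le_trans (ler_norm_sum _ _ _)).
apply: ler_sum => i _; rewrite !normrM normr_nat.
rewrite [leRHS](_ : _ = 'C(j, i)%:R * ((K * r ^+ i) * (L * s ^+ (j - i)))).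
  by rewrite ler_wpM2l ?ler0n // ler_pM.
by rewrite -mulr_natl; ring.
Qed.

(* Mertens: the product of the partial sums differs from the partial sum of the
   Cauchy product by at most a tail of a dominating exponential series. *)
Lemma expsum_conv u v : geometric_growth u -> geometric_growth v ->
  expsum (binomial_conv u v) = expsum u * expsum v.
Proof.
move=> gu gv; have gc := geometric_growth_conv gu gv.
have [K [r [K0 r0 ur]]] := gu; have [L [s [L0 s0 vs]]] := gv.
pose al j : C := (j`!%:R)^-1 * (K * r ^+ j).
pose be j : C := (j`!%:R)^-1 * (L * s ^+ j).
pose S (f : nat -> C) N : C := \sum_(0 <= j < N) f j.
(* The triangle i + j < N of index pairs, cut into slices of constant i. *)
have term_conv (f g : nat -> C) N : S (expsum_term (binomial_conv f g)) N =
    \sum_(0 <= i < N) expsum_term f i * S (expsum_term g) (N - i)%N.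
  rewrite /S; elim: N => [|N IH]; first by rewrite !big_geq.
  rewrite !big_nat_recr //= IH subSnn big_nat1.
  rewrite [X in _ = X + _](_ : _ = \sum_(0 <= i < N)
      (expsum_term f i * \sum_(0 <= j < N - i) expsum_term g j
       + expsum_term f i * expsum_term g (N - i)%N)); last first.
    rewrite !big_nat; apply: eq_bigr => i /andP[_ iN].
    by rewrite subSn 1?ltnW // big_nat_recr //= mulrDr.
  rewrite big_split -addrA; congr +%R.
  rewrite /expsum_term /binomial_conv mulr_sumr big_ord_recr /= binn subnn.
  rewrite fact0 invr1 !mul1r big_mkord; congr +%R; last by rewrite mulrA.
  apply: eq_bigr => i _; rewrite -(bin_fact (ltnW (ltn_ord i))) !natrM.
  have fact_neq0 k : k`!%:R != 0 :> C by rewrite pnatr_eq0 -lt0n fact_gt0.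
  have b0 : 'C(N, i)%:R != 0 :> C by rewrite pnatr_eq0 -lt0n bin_gt0 ltnW.
  by field; rewrite b0 !fact_neq0.
pose w := binomial_conv (fun j => K * r ^+ j) (fun j => L * s ^+ j).
have gw : geometric_growth w.
  apply: geometric_growth_conv; [exists K, r|exists L, s]; split=> // j;
  by rewrite ger0_norm // mulr_ge0 // exprn_ge0.
have al0 j : 0 <= al j by rewrite mulr_ge0 ?invr_ge0 ?ler0n // mulr_ge0 // exprn_ge0.
have be0 j : 0 <= be j by rewrite mulr_ge0 ?invr_ge0 ?ler0n // mulr_ge0 // exprn_ge0.
have al_ge j : `|expsum_term u j| <= al j.
  by rewrite normrM ger0_norm ?invr_ge0 ?ler0n // ler_wpM2l ?invr_ge0 ?ler0n.
have be_ge j : `|expsum_term v j| <= be j.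
  by rewrite normrM ger0_norm ?invr_ge0 ?ler0n // ler_wpM2l ?invr_ge0 ?ler0n.
have Ssub (f : nat -> C) a b : (a <= b)%N -> S f b - S f a = \sum_(a <= j < b) f j.
  by move=> ab; rewrite /S (big_cat_nat (n := a)) //= addrAC subrr add0r.
(* The square i, j < N minus the triangle i + j < N lies in the strip N <= i + j < 2N, over which
   the majorants sum to a difference of two partial sums for [w]. *)
have key N : `|S (expsum_term u) N * S (expsum_term v) N -
     S (expsum_term (binomial_conv u v)) N| <=
     S (expsum_term w) (N + N)%N - S (expsum_term w) N.
  rewrite !term_conv {1}/S mulr_suml -sumrB.
  apply: (le_trans (ler_norm_sum _ _ _)).
  apply: (@le_trans _ _ (\sum_(0 <= i < N) al i * (S be (N + N - i)%N - S be (N - i)%N))).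
    rewrite !big_nat; apply: ler_sum => i /andP[_ iN].
    rewrite -mulrBr normrM; apply: ler_pM => //.
    rewrite (Ssub (expsum_term v)) ?leq_subr // (Ssub be); last by rewrite leq_sub2r // leq_addr.
    apply: (le_trans (ler_norm_sum _ _ _)).
    rewrite [leRHS](big_cat_nat (n := N)) ?leq_subr //=; last first.
      by rewrite -addnBA ?leq_addr // ltnW.
    rewrite -[leLHS]addr0 lerD //; first by apply: ler_sum.
    by apply: sumr_ge0.
  rewrite -[X in _ <= X - _]/(S _ _).
  rewrite [X in _ <= X - _](big_cat_nat (n := N)) ?leq_addr //=.
  under eq_bigr do rewrite mulrBr.
  rewrite sumrB addrAC lerDl; apply: sumr_ge0 => i _.
  by rewrite mulr_ge0 //; apply: sumr_ge0.
apply: expsum_unique.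
have pc : (fun N => S (expsum_term u) N * S (expsum_term v) N) @ \oo -->
    (expsum u * expsum v : C^o).
  by apply: cvgM; exact: expsumP.
have tail : (fun N => S (expsum_term w) (N + N)%N - S (expsum_term w) N)
    @ \oo --> (0 : C^o).
  have dbl : (fun N => S (expsum_term w) (N + N)%N : C^o) @ \oo --> (expsum w : C^o).
    apply: cvg_comp (expsumP gw); apply/cvgnyPge => A; near=> N.
    by rewrite (leq_trans _ (leq_addr _ _)) //; near: N; exact: nbhs_infty_ge.
  rewrite (_ : 0 = expsum w - expsum w); last by rewrite subrr.
  exact: cvg_complexB dbl (expsumP gw).
rewrite -[X in _ --> X]subr0.
rewrite (_ : expsum_partial _ = fun N => S (expsum_term u) N * S (expsum_term v) N -
   (S (expsum_term u) N * S (expsum_term v) N -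
    S (expsum_term (binomial_conv u v)) N)); last first.
  by apply/funext => N; rewrite subKr.
apply: (cvg_complexB pc); apply/cvg_complexP => e e0.
have /cvg_complexP/(_ e e0) := tail; apply: filterS => N; rewrite !subr0 => h.
apply: le_trans h; apply: (le_trans (key N)); rewrite ger0_norm //.
exact: le_trans (key N).
Unshelve. all: by end_near. Qed.

End ExponentialSums.

(** * Power series as limits of polynomials *)

Section PowerSeries.
Variables (R : realType) (n : nat).
Local Notation C := R[i].
Local Notation F := (fps R n).
Implicit Types (g h : F) (X Y : fps_tuple R n).

Lemma fpsDE g h m : (g + h) m = g m + h m. Proof. by []. Qed.
Lemma fpsNE g m : (- g) m = - g m. Proof. by []. Qed.
Lemma fpsBE g h m : (g - h) m = g m - h m. Proof. by []. Qed.
Lemma fpsZE (c : C) g m : (c *: g) m = c * g m. Proof. by []. Qed.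

Definition vanish (d : nat) g : Prop := forall m, (mdeg m < d)%N -> g m = 0.

(** Each coefficient of a product or a derivative involves finitely many coefficients of the
    operands. Identities between series can thus be checked on truncations, where the ring structure
    and the derivations of polynomials are at hand. *)
Definition fps_approx (d : nat) (p : mpoly n C) g : Prop :=
  forall m, (mdeg m < d)%N -> mcoeff m p = g m.

Definition fps_trunc (d : nat) g : mpoly n C :=
  \sum_(m : bmultinom n d) g m *: mpolyX C m.

Lemma approx_trunc d g : fps_approx d (fps_trunc d g) g.
Proof. by move=> m md; rewrite /fps_trunc mcoeff_mpoly. Qed.

Lemma approx_eq g h :
  (forall d, exists2 p, fps_approx d p g & fps_approx d p h) -> g = h.
Proof.
move=> gh; apply/funext => m; have [p pg ph] := gh (mdeg m).+1.
by rewrite -pg // ph.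
Qed.

Lemma approx_le d e p g : (d <= e)%N -> fps_approx e p g -> fps_approx d p g.
Proof. by move=> de pg m md; apply: pg; apply: leq_trans de. Qed.

Lemma approxM d p q g h : fps_approx d p g -> fps_approx d q h ->
  fps_approx d (p * q) (fps_mul g h).
Proof.
move=> pg qh m md; rewrite mcoeffM /fps_mul; apply: eq_bigr => k /eqP mk.
have mdk : mdeg m = (mdeg k.1 + mdeg k.2)%N by rewrite [in LHS]mk mdegD.
rewrite pg ?qh //; apply: leq_ltn_trans md.
  by rewrite (leq_trans (leq_addl (mdeg k.1) _)) // eq_leq.
by rewrite (leq_trans (leq_addr (mdeg k.2) _)) // eq_leq.
Qed.

Lemma approx_deriv d j p g : fps_approx d.+1 p g -> fps_approx d (mderiv j p) (fps_deriv j g).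
Proof.
by move=> pg m md; rewrite mcoeff_deriv /fps_deriv pg // mdegD mdeg1 addn1.
Qed.

Lemma approxD d p q g h : fps_approx d p g -> fps_approx d q h -> fps_approx d (p + q) (g + h).
Proof. by move=> pg qh m md; rewrite mcoeffD pg ?qh. Qed.

Lemma approxB d p q g h : fps_approx d p g -> fps_approx d q h -> fps_approx d (p - q) (g - h).
Proof. by move=> pg qh m md; rewrite mcoeffB pg ?qh. Qed.

(** * Derivations and their commutators *)

Definition mpoly_vf (a : 'I_n -> mpoly n C) (p : mpoly n C) : mpoly n C :=
  \sum_j a j * mderiv j p.

Lemma approx_vf d (a : 'I_n -> mpoly n C) (X : fps_tuple R n) p g :
  (forall j, fps_approx d (a j) (X j)) -> fps_approx d.+1 p g ->
  fps_approx d (mpoly_vf a p) (vf_apply X g).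
Proof.
move=> aX pg m md; rewrite /mpoly_vf raddf_sum /vf_apply; apply: eq_bigr => j _.
exact: (approxM (aX j) (approx_deriv j pg)).
Qed.

Lemma mpoly_vfM a p q : mpoly_vf a (p * q) = mpoly_vf a p * q + p * mpoly_vf a q.
Proof.
rewrite /mpoly_vf mulr_suml mulr_sumr -big_split; apply: eq_bigr => j _ /=.
by rewrite mderivM; ring.
Qed.

Lemma vf_applyM X g h :
  vf_apply X (fps_mul g h) = fps_mul (vf_apply X g) h + fps_mul g (vf_apply X h).
Proof.
apply: approx_eq => d; pose a j := fps_trunc d.+1 (X j).
have aX j : fps_approx d (a j) (X j) by apply: (approx_le (leqnSn d)); apply: approx_trunc.
have ag := @approx_trunc d.+1 g; have ah := @approx_trunc d.+1 h.
exists (mpoly_vf a (fps_trunc d.+1 g * fps_trunc d.+1 h)).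
  by apply: approx_vf => //; apply: approxM.
have ag' : fps_approx d (fps_trunc d.+1 g) g by apply: (approx_le (leqnSn d)).
have ah' : fps_approx d (fps_trunc d.+1 h) h by apply: (approx_le (leqnSn d)).
by rewrite mpoly_vfM; apply: approxD; apply: approxM => //; apply: approx_vf.
Qed.

Definition vf_bracket (X Y : fps_tuple R n) : fps_tuple R n :=
  fun i => vf_apply X (Y i) - vf_apply Y (X i).

(** Both compositions have the same second-order part because partial derivatives commute; only
    first-order terms survive in the commutator. *)
Lemma mpoly_vf_bracket a b p :
  mpoly_vf (fun i => mpoly_vf a (b i) - mpoly_vf b (a i)) p =
  mpoly_vf a (mpoly_vf b p) - mpoly_vf b (mpoly_vf a p).
Proof.
have expand c e : mpoly_vf c (mpoly_vf e p) =
    \sum_j mpoly_vf c (e j) * mderiv j p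
    + \sum_i \sum_j c i * e j * mderiv i (mderiv j p).
  rewrite {1}/mpoly_vf exchange_big -big_split /= /mpoly_vf.
  under eq_bigr do rewrite raddf_sum mulr_sumr.
  rewrite exchange_big; apply: eq_bigr => j _.
  rewrite mulr_suml -big_split; apply: eq_bigr => i _ /=.
  by rewrite mderivM; ring.
rewrite !expand opprD addrACA [X in _ = _ + X](_ : _ = 0) ?addr0; last first.
  apply/eqP; rewrite subr_eq0 exchange_big /=; apply/eqP.
  apply: eq_bigr => j _; apply: eq_bigr => i _.
  by rewrite mderiv_comm; ring.
by rewrite -sumrB; apply: eq_bigr => j _; rewrite mulrBl.
Qed.

Lemma vf_apply_bracket X Y g :
  vf_apply (vf_bracket X Y) g = vf_apply X (vf_apply Y g) - vf_apply Y (vf_apply X g).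
Proof.
apply: approx_eq => d.
pose a j := fps_trunc d.+1 (X j); pose b j := fps_trunc d.+1 (Y j).
have aX j : fps_approx d.+1 (a j) (X j) := @approx_trunc _ _.
have bY j : fps_approx d.+1 (b j) (Y j) := @approx_trunc _ _.
have aX' j : fps_approx d (a j) (X j) by apply: approx_le (aX j).
have bY' j : fps_approx d (b j) (Y j) by apply: approx_le (bY j).
(* Each derivative costs one degree of precision: [g] is differentiated twice, the coefficients of
   the fields once. *)
pose p := fps_trunc d.+2 g.
have pg : fps_approx d.+2 p g := @approx_trunc _ _.
exists (mpoly_vf (fun i => mpoly_vf a (b i) - mpoly_vf b (a i)) p).
  apply: approx_vf => [j|]; last exact: approx_le pg.
  by apply: approxB; apply: approx_vf.
rewrite mpoly_vf_bracket; apply: approxB.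
  by apply: approx_vf => //; apply: approx_vf.
by apply: approx_vf => //; apply: approx_vf.
Qed.

Lemma vf_apply_coord X i : vf_apply X (fps_coord R i) = X i.
Proof.
apply: approx_eq => d; pose a j := fps_trunc d.+1 (X j).
have aX j : fps_approx d (a j) (X j) by apply: (approx_le (leqnSn d)); apply: approx_trunc.
exists (mpoly_vf a (mpolyX C (mnm1 i))).
  apply: approx_vf => // m _; by rewrite mcoeffX /fps_coord eq_sym.
rewrite /mpoly_vf (bigD1 i) //= big1 ?addr0.
  rewrite mderivX mnm1E eqxx scale1r.
  rewrite (_ : mnm_sub _ _ = mnm0); last first.
    by apply/mnmP => j; rewrite mnmBE mnm0E subnn.
  by rewrite mpolyX0 mulr1.
by move=> j ji; rewrite mderivX mnm1E eq_sym (negbTE ji) scale0r mulr0.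
Qed.

(** * Orders of vanishing *)

Lemma vanish0 g : vanish 0 g. Proof. by []. Qed.

Lemma vanish_le d e g : (d <= e)%N -> vanish e g -> vanish d g.
Proof. by move=> de vg m md; apply: vg; apply: leq_trans de. Qed.

Lemma vanishD d g h : vanish d g -> vanish d h -> vanish d (g + h).
Proof. by move=> vg vh m md; rewrite fpsDE vg ?vh ?addr0. Qed.

Lemma vanishN d g : vanish d g -> vanish d (- g).
Proof. by move=> vg m md; rewrite fpsNE vg ?oppr0. Qed.

Lemma vanishB d g h : vanish d g -> vanish d h -> vanish d (g - h).
Proof. by move=> vg vh; apply: vanishD => //; apply: vanishN. Qed.

(** Differentiation costs one order and the coefficients of [X] contribute [q]. The truncated [d.-1]
    is right at 0 as well, where there is no order to lose. *)
Lemma vanish_vf q d X g : (forall j, vanish q (X j)) -> vanish d g ->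
  vanish (q + d.-1) (vf_apply X g).
Proof.
move=> vX vg m md; rewrite /vf_apply big1 // => j _.
rewrite /fps_mul big1 // => k /eqP mk.
have mdk : mdeg m = (mdeg k.1 + mdeg k.2)%N by rewrite [in LHS]mk mdegD.
have [kq|kq] := ltnP (mdeg k.1) q; first by rewrite vX // mul0r.
rewrite /fps_deriv vg ?mul0rn ?mulr0 // mdegD mdeg1.
by move: mdk kq md; move: (mdeg m) (mdeg k.2) (mdeg k.1); lia.
Qed.

Lemma vf_apply_linear X : linear (vf_apply X).
Proof.
move=> c g h; apply/funext => m.
rewrite fpsDE fpsZE /vf_apply mulr_sumr -big_split.
apply: eq_bigr => j _ /=; rewrite /fps_mul mulr_sumr -big_split.
apply: eq_bigr => k _ /=; rewrite /fps_deriv.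
rewrite fpsDE fpsZE mulrnDl -mulrnAr; ring.
Qed.

Lemma vf_applyZ (c : C) X g : vf_apply X (c *: g) = c *: vf_apply X g.
Proof.
apply/funext => m; rewrite fpsZE /vf_apply mulr_sumr; apply: eq_bigr => j _.
rewrite /fps_mul mulr_sumr; apply: eq_bigr => k _.
by rewrite /fps_deriv fpsZE -mulrnAr mulrCA.
Qed.

Lemma vf_applyDl X Y g : vf_apply (X + Y) g = vf_apply X g + vf_apply Y g.
Proof.
apply/funext => m; rewrite fpsDE /vf_apply.
rewrite -big_split; apply: eq_bigr => j _ /=; rewrite /fps_mul -big_split.
by apply: eq_bigr => k _ /=; rewrite -mulrDl.
Qed.

Lemma vf_applyZl (c : C) X g : vf_apply (fun i => c *: X i) g = c *: vf_apply X g.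
Proof.
apply/funext => m; rewrite fpsZE /vf_apply.
rewrite mulr_sumr; apply: eq_bigr => j _ /=; rewrite /fps_mul mulr_sumr.
by apply: eq_bigr => k _ /=; rewrite mulrA.
Qed.

Lemma vf_applyNl X g : vf_apply (- X) g = - vf_apply X g.
Proof.
rewrite -[RHS]scaleN1r -vf_applyZl; congr vf_apply; apply/funext => i.
by rewrite scaleN1r.
Qed.

Lemma vf_applyBl X Y g : vf_apply (X - Y) g = vf_apply X g - vf_apply Y g.
Proof. by rewrite vf_applyDl vf_applyNl. Qed.

End PowerSeries.

(** * Exponentials of triangular operators *)

(** The inductive step common to the two binomial formulas below, for two-sided composition and for
    derivatives of products. *)
Lemma sum_pascal (V : zmodType) (f : nat -> V) (j : nat) :
  \sum_(i < j.+2) f i *+ 'C(j.+1, i) =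
  \sum_(i < j.+1) f i.+1 *+ 'C(j, i) + \sum_(i < j.+1) f i *+ 'C(j, i).
Proof.
rewrite big_ord_recl bin0 /=.
under eq_bigr do rewrite /bump /= add1n binS mulrnDr.
rewrite big_split /= addrA [RHS]addrC; congr (_ + _).
rewrite -[RHS]addr0 -[X in _ = _ + X](mulr0n (f j.+1)).
rewrite -[in RHS](bin_small (ltnSn j)) -(big_ord_recr _ (fun i => f i *+ 'C(j, i))) /=.
rewrite [RHS]big_ord_recl bin0; congr (_ + _); by apply: eq_bigr.
Qed.

Section Operators.
Variables (R : realType) (n : nat).
Local Notation C := R[i].
Local Notation F := (fps R n).
Implicit Types (g h : F) (X Y : fps_tuple R n) (A B T U : F -> F).

(* Triangular with respect to the degree; this makes each coefficient of [T g]
   depend on finitely many coefficients of [g]. *)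
Definition triangular T : Prop :=
  linear T /\ forall d g, vanish d g -> vanish d (T g).

Lemma triangularP T c g h : triangular T -> T (c *: g + h) = c *: T g + T h.
Proof. by move=> [tT _]; exact: tT. Qed.

Lemma triangular0 T : triangular T -> T 0 = 0.
Proof.
move=> tT; have := triangularP 1 0 0 tT; rewrite !scale1r addr0 => /eqP.
by rewrite -subr_eq0 opprD addNKr oppr_eq0 => /eqP.
Qed.

Lemma triangularZ T c g : triangular T -> T (c *: g) = c *: T g.
Proof. by move=> tT; rewrite -[c *: g]addr0 triangularP // triangular0 // addr0. Qed.

Lemma triangularD T g h : triangular T -> T (g + h) = T g + T h.
Proof. by move=> tT; rewrite -{1}[g]scale1r triangularP // scale1r. Qed.

Lemma triangularN T g : triangular T -> T (- g) = - T g.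
Proof. by move=> tT; rewrite -scaleN1r triangularZ // scaleN1r. Qed.

Lemma triangularMn T g k : triangular T -> T (g *+ k) = T g *+ k.
Proof.
move=> tT; elim: k => [|k IH]; first by rewrite !mulr0n triangular0.
by rewrite !mulrS triangularD // IH.
Qed.

Lemma triangular_bigsum (I : Type) (r : seq I) (P : pred I) (G : I -> F) T :
  triangular T -> T (\sum_(i <- r | P i) G i) = \sum_(i <- r | P i) T (G i).
Proof.
move=> tT; apply: big_morph => [g h|]; [exact: triangularD|exact: triangular0].
Qed.

Lemma triangular_comp T U : triangular T -> triangular U -> triangular (T \o U).
Proof.
move=> tT tU; split=> [c g h /=|d g vg]; first by rewrite !triangularP.
by apply: tT.2; apply: tU.2.
Qed.

Lemma triangular_id : triangular idfun.
Proof. by split. Qed.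

Lemma triangular_opp T : triangular T -> triangular (fun g => - T g).
Proof.
move=> tT; split=> [c g h|d g vg]; last by apply: vanishN; apply: tT.2.
by rewrite triangularP // opprD scalerN.
Qed.

Lemma triangular_iter T j : triangular T -> triangular (iter j T).
Proof.
by move=> tT; elim: j => [|j IH]; [exact: triangular_id|exact: (triangular_comp tT IH)].
Qed.

Definition fps_mono (k : multinom n) : F := fun m => (m == k)%:R.

Lemma fps_sumE (I : Type) (r : seq I) (P : pred I) (G : I -> F) m :
  (\sum_(i <- r | P i) G i) m = \sum_(i <- r | P i) G i m.
Proof. exact: (big_morph (fun g : F => g m)). Qed.

Lemma fpsMnE g k m : (g *+ k) m = g m *+ k.
Proof. by rewrite -scaler_nat fpsZE mulr_natl. Qed.

(** The part of [g] of order at least [d] cannot reach [m], and the rest is a finite combination of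
    monomials. [T] thereby becomes a finite matrix, through which limits pass. *)
Lemma triangularE T d g m : triangular T -> (mdeg m < d)%N ->
  T g m = \sum_(k : bmultinom n d) g k * T (fps_mono k) m.
Proof.
move=> tT md; pose s : F := \sum_(k : bmultinom n d) g k *: fps_mono k.
have sg : vanish d (g - s).
  move=> l ld; rewrite fpsBE /s fps_sumE (bigD1 (BMultinom ld)) //= big1.
    by rewrite fpsZE /fps_mono eqxx mulr1 addr0 subrr.
  move=> k; rewrite -val_eqE /= => kl.
  by rewrite fpsZE /fps_mono eq_sym (negbTE kl) mulr0.
rewrite -[g in LHS](subrK s) triangularD // fpsDE (tT.2 _ _ sg) // add0r.
rewrite /s triangular_bigsum // fps_sumE; apply: eq_bigr => k _.
by rewrite triangularZ.
Qed.

Lemma geometric_growth_iter T g m : triangular T ->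
  geometric_growth (fun j => iter j T g m).
Proof.
move=> tT; pose d := (mdeg m).+1.
pose nrm h : C := \sum_(k : bmultinom n d) `|h k|.
(* The sum of all absolute matrix entries of [T] on jets bounds its operator norm for the l1 norm
   [nrm]. *)
pose r : C := \sum_(l : bmultinom n d) \sum_(k : bmultinom n d) `|T (fps_mono k) l|.
have r0 : 0 <= r by apply: sumr_ge0 => l _; apply: sumr_ge0.
have nrm_ge0 h : 0 <= nrm h by apply: sumr_ge0.
have le_nrm h (k : bmultinom n d) : `|h k| <= nrm h.
  by rewrite /nrm (bigD1 k) //= lerDl sumr_ge0.
have step h : nrm (T h) <= r * nrm h.
  rewrite /r mulr_suml; apply: ler_sum => l _.
  rewrite (triangularE (d := d)) ?bmdeg // mulr_suml.
  apply: (le_trans (ler_norm_sum _ _ _)); apply: ler_sum => k _.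
  by rewrite normrM mulrC ler_wpM2l.
have all_steps j : nrm (iter j T g) <= nrm g * r ^+ j.
  elim: j => [|j IH]; first by rewrite expr0 mulr1.
  apply: (le_trans (step _)); rewrite exprS mulrCA; exact: ler_wpM2l.
exists (nrm g), r; split=> // j; apply: le_trans (all_steps j).
exact: (le_nrm _ (BMultinom (ltnSn (mdeg m)))).
Qed.

Lemma geometric_growth_triangular T (u : nat -> F) m : triangular T ->
  (forall k, geometric_growth (fun j => u j k)) ->
  geometric_growth (fun j => T (u j) m).
Proof.
move=> tT gu.
rewrite (_ : (fun _ => _) = fun j =>
  \sum_(k : bmultinom n (mdeg m).+1) T (fps_mono k) m * u j k).
  by apply: geometric_growth_sum => k; apply: geometric_growthZ.
apply/funext => j; rewrite (triangularE (d := (mdeg m).+1)) //.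
by apply: eq_bigr => k _; rewrite mulrC.
Qed.

Lemma expsum_triangular T (u : nat -> F) m : triangular T ->
  (forall k, geometric_growth (fun j => u j k)) ->
  expsum (fun j => T (u j) m) = T (fun k => expsum (fun j => u j k)) m.
Proof.
move=> tT gu.
rewrite (_ : (fun j => T (u j) m) = fun j =>
  \sum_(k : bmultinom n (mdeg m).+1) T (fps_mono k) m * u j k).
  rewrite expsum_sum; last by move=> k; apply: geometric_growthZ.
  rewrite (triangularE (d := (mdeg m).+1)) //; apply: eq_bigr => k _.
  by rewrite expsumZ // mulrC.
apply/funext => j; rewrite (triangularE (d := (mdeg m).+1)) //.
by apply: eq_bigr => k _; rewrite mulrC.
Qed.

Definition opexp T g : F := fun m => expsum (fun j => iter j T g m).

Lemma opexpE T d g m : triangular T -> (mdeg m < d)%N ->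
  opexp T g m = \sum_(k : bmultinom n d) g k * opexp T (fps_mono k) m.
Proof.
move=> tT md; have gi k := geometric_growth_iter (fps_mono k) m tT.
rewrite {1}/opexp (_ : (fun j => _) = fun j =>
  \sum_(k : bmultinom n d) g k * iter j T (fps_mono k) m).
  rewrite expsum_sum; last by move=> k; apply: geometric_growthZ.
  by apply: eq_bigr => k _; rewrite expsumZ.
by apply/funext => j; rewrite (triangularE (d := d)) //; apply: triangular_iter.
Qed.

Lemma triangular_opexp T : triangular T -> triangular (opexp T).
Proof.
move=> tT; split=> [c g h|d g vg m md]; last first.
  by rewrite (opexpE (d := d)) // big1 // => k _; rewrite vg ?bmdeg // mul0r.
apply/funext => m; rewrite fpsDE fpsZE !(opexpE (d := (mdeg m).+1)) //.
rewrite mulr_sumr -big_split; apply: eq_bigr => k _ /=.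
by rewrite fpsDE fpsZE; ring.
Qed.

Lemma opexp_commute T A g : triangular T -> triangular A ->
  (forall h, T (A h) = A (T h)) -> T (opexp A g) = opexp A (T g).
Proof.
move=> tT tA TA; apply/funext => m; rewrite /opexp -expsum_triangular //.
  congr expsum; apply/funext => j; congr (_ m).
  by elim: j => //= j <-; rewrite TA.
by move=> k; apply: geometric_growth_iter.
Qed.

(** Left composition with [A] and right composition with [B] commute, so the exponential of their
    sum sends U to exp(A) U exp(B). For B = -A this is Hadamard's formula for exp(ad A); keeping [B]
    free also covers exp(sX) V exp(-sX'). *)
Definition twist A B U : F -> F := fun g => A (U g) + U (B g).

Lemma iter_twist A B U j g : triangular A ->
  iter j (twist A B) U g =
  \sum_(i < j.+1) iter i A (U (iter (j - i) B g)) *+ 'C(j, i).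
Proof.
move=> tA; elim: j g => [|j IH] g; first by rewrite big_ord1 bin0.
rewrite iterS /twist !IH (triangular_bigsum _ _ _ tA).
rewrite (sum_pascal (fun i => iter i A (U (iter (j.+1 - i) B g)))).
congr (_ + _); apply: eq_bigr => i _; first by rewrite triangularMn // subSS.
by rewrite subSn -1?ltnS // iterSr.
Qed.

(** Inserting the monomial basis between the two factors turns a composition of operators into
    finitely many scalar convolutions, to which [expsum_conv] applies. *)
Lemma twist_coef A B U j g m : triangular A -> triangular U ->
  iter j (twist A B) U g m =
  \sum_(k : bmultinom n (mdeg m).+1)
    binomial_conv (fun i => iter i A (U (fps_mono k)) m) (fun i => iter i B g k) j.
Proof.
move=> tA tU; rewrite iter_twist // fps_sumE exchange_big; apply: eq_bigr => i _ /=.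
have tAU := triangular_comp (triangular_iter i tA) tU.
rewrite fpsMnE -[iter i A _]/((iter i A \o U) _) (triangularE (d := (mdeg m).+1)) //.
rewrite -sumrMnl; apply: eq_bigr => k _ /=.
by rewrite mulr_natl [X in _ = X *+ _]mulrC.
Qed.

Lemma geometric_growth_twist A B U g m :
  triangular A -> triangular B -> triangular U ->
  geometric_growth (fun j => iter j (twist A B) U g m).
Proof.
move=> tA tB tU; under eq_fun do rewrite twist_coef //.
by apply: geometric_growth_sum => k; apply: geometric_growth_conv;
  apply: geometric_growth_iter.
Qed.

Lemma expsum_twist A B U g m :
  triangular A -> triangular B -> triangular U ->
  expsum (fun j => iter j (twist A B) U g m) = opexp A (U (opexp B g)) m.
Proof.
move=> tA tB tU; under eq_fun do rewrite twist_coef //.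
rewrite expsum_sum; last first.
  by move=> k; apply: geometric_growth_conv; apply: geometric_growth_iter.
have tAU := triangular_comp (triangular_opexp tA) tU.
rewrite -[RHS]/((opexp A \o U) _ m) (triangularE (d := (mdeg m).+1)) //.
apply: eq_bigr => k _; rewrite expsum_conv; first by rewrite mulrC.
  exact: geometric_growth_iter.
exact: geometric_growth_iter.
Qed.

Lemma opexp_oppK A g : triangular A -> opexp A (opexp (fun h => - A h) g) = g.
Proof.
move=> tA; apply/funext => m.
rewrite -[opexp _ g]/(idfun (opexp _ g)) -expsum_twist //; last exact: triangular_opp.
(* The identity commutes with [A], hence is killed by the twist, and only the term of index 0
   remains. *)
rewrite expsum_single // => j; rewrite iterSr.
rewrite (_ : twist _ _ _ = fun=> 0); last by apply/funext => h; rewrite /twist /= subrr.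
rewrite (_ : iter j _ _ = fun=> 0) //; elim: j => //= j ->.
by apply/funext => h; rewrite /twist /= (triangular0 tA); exact: addr0.
Qed.

End Operators.

(** * Exponentials of vector fields *)

Section VectorFields.
Variables (R : realType) (n : nat).
Local Notation C := R[i].
Local Notation F := (fps R n).
Implicit Types (g h : F) (X Y V W : fps_tuple R n).

Definition vf_vanish (d : nat) X : Prop := forall i, vanish d (X i).

Lemma formal_vector_fieldE X : formal_vector_field X <-> vf_vanish 1 X.
Proof.
split=> [X0 i m|X1 i]; last by apply: X1; rewrite mdeg0.
by rewrite ltnS leqn0 mdeg_eq0 => /eqP ->; exact: X0.
Qed.

Lemma vf_vanish_le d e X : (d <= e)%N -> vf_vanish e X -> vf_vanish d X.
Proof. by move=> de vX i; apply: vanish_le (vX i). Qed.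

Lemma triangular_vf X : vf_vanish 1 X -> triangular (vf_apply X).
Proof.
move=> X1; split=> [|d g vg]; first exact: vf_apply_linear.
by apply: vanish_le (vanish_vf X1 vg); lia.
Qed.

(** Stated with the degree shift of the derivation, one less than the order of its coefficients,
    because brackets add shifts. *)
Lemma vf_vanish_bracket p q X Y : vf_vanish p.+1 X -> vf_vanish q.+1 Y ->
  vf_vanish (p + q).+1 (vf_bracket X Y).
Proof.
move=> vX vY i; apply: vanishB.
  by apply: vanish_le (vanish_vf vX (vY i)); lia.
by apply: vanish_le (vanish_vf vY (vX i)); lia.
Qed.

Lemma vf_apply_bracket_twist X Y : vf_vanish 1 X ->
  vf_apply (vf_bracket X Y) =
  twist (vf_apply X) (fun g => - vf_apply X g) (vf_apply Y).
Proof.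
move=> X1; apply/funext => g; rewrite vf_apply_bracket /twist.
by congr (_ + _); rewrite -scaleN1r -[in RHS]scaleN1r vf_applyZ.
Qed.

(** Moves exp(ad X) from fields to operators, where it is a conjugation; evaluation at the
    coordinates moves it back. *)
Lemma vf_apply_iter_bracket X Y j : vf_vanish 1 X ->
  vf_apply (iter j (vf_bracket X) Y) =
  iter j (twist (vf_apply X) (fun g => - vf_apply X g)) (vf_apply Y).
Proof.
by move=> X1; elim: j => //= j <-; rewrite vf_apply_bracket_twist.
Qed.

Lemma geometric_growth_iter_bracket X Y i m : vf_vanish 1 X -> vf_vanish 1 Y ->
  geometric_growth (fun j => iter j (vf_bracket X) Y i m).
Proof.
move=> X1 Y1; rewrite (_ : (fun _ => _) = fun j =>
  iter j (twist (vf_apply X) (fun g => - vf_apply X g)) (vf_apply Y) (fps_coord R i) m).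
  apply: geometric_growth_twist; [|apply: triangular_opp|]; exact: triangular_vf.
by apply/funext => j; rewrite -vf_apply_iter_bracket // vf_apply_coord.
Qed.

Lemma vf_apply_expsum (x : nat -> fps_tuple R n) g m :
  (forall i l, geometric_growth (fun j => x j i l)) ->
  vf_apply (fun i l => expsum (fun j => x j i l)) g m =
  expsum (fun j => vf_apply (x j) g m).
Proof.
move=> gx; rewrite /vf_apply /fps_mul.
have gt i (k : bmultinom n (mdeg m).+1 * bmultinom n (mdeg m).+1) :
    geometric_growth (fun j => fps_deriv i g k.2 * x j i k.1).
  exact: geometric_growthZ.
rewrite expsum_sum; last first.
  by move=> i; apply: geometric_growth_sum => k; under eq_fun do rewrite mulrC.
apply: eq_bigr => i _; rewrite expsum_sum; last first.
  by move=> k; under eq_fun do rewrite mulrC.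
by apply: eq_bigr => k _; rewrite mulrC -expsumZ //; congr expsum;
  apply/funext => j; rewrite mulrC.
Qed.

Lemma iter_vfM X j g h : vf_vanish 1 X ->
  iter j (vf_apply X) (fps_mul g h) =
  \sum_(i < j.+1)
    fps_mul (iter i (vf_apply X) g) (iter (j - i) (vf_apply X) h) *+ 'C(j, i).
Proof.
move=> X1; have tX := triangular_vf X1.
elim: j => [|j IH]; first by rewrite big_ord1 bin0.
rewrite iterS IH (triangular_bigsum _ _ _ tX).
under eq_bigr do rewrite (triangularMn _ _ tX) vf_applyM mulrnDl.
rewrite big_split /= (sum_pascal (fun i => fps_mul (iter i (vf_apply X) g)
  (iter (j.+1 - i) (vf_apply X) h))).
by congr (_ + _); apply: eq_bigr => i _; rewrite ?subSS // subSn // -ltnS.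
Qed.

(** By Leibniz's formula each pair of coefficients contributes a [binomial_conv], whose exponential
    sum is a product. *)
Lemma opexp_vfM X g h : vf_vanish 1 X ->
  opexp (vf_apply X) (fps_mul g h) =
  fps_mul (opexp (vf_apply X) g) (opexp (vf_apply X) h).
Proof.
move=> X1; have tX := triangular_vf X1; apply/funext => m.
rewrite {1}/opexp (_ : (fun j => _) = fun j =>
  \sum_(k : bmultinom n (mdeg m).+1 * bmultinom n (mdeg m).+1
         | m == mnm_add k.1 k.2)
    binomial_conv (fun i => iter i (vf_apply X) g k.1)
                  (fun i => iter i (vf_apply X) h k.2) j).
  rewrite expsum_sum; last first.
    by move=> k; apply: geometric_growth_conv; apply: geometric_growth_iter.
  by apply: eq_bigr => k _; rewrite expsum_conv //; apply: geometric_growth_iter.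
apply/funext => j; rewrite iter_vfM // fps_sumE exchange_big.
apply: eq_bigr => i _ /=; rewrite fpsMnE /fps_mul -sumrMnl.
by apply: eq_bigr => k _; rewrite mulr_natl.
Qed.

Lemma approx_mono (d : nat) (k : multinom n) : fps_approx d (mpolyX C k) (fps_mono R k).
Proof. by move=> m _; rewrite mcoeffX /fps_mono eq_sym. Qed.

Lemma fps_mul_mono k l :
  fps_mul (fps_mono R k) (fps_mono R l) = fps_mono R (mnm_add k l) :> F.
Proof.
apply: approx_eq => d; exists (mpolyX C k * mpolyX C l).
  by apply: approxM; exact: approx_mono.
by rewrite -mpolyXD; exact: approx_mono.
Qed.

Lemma opexp_vf_one X : vf_vanish 1 X ->
  opexp (vf_apply X) (fps_mono R mnm0) = fps_mono R mnm0.
Proof.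
move=> X1; apply/funext => m; rewrite /opexp expsum_single // => j.
rewrite iterSr (_ : vf_apply X _ = 0).
  by rewrite (triangular0 (triangular_iter j (triangular_vf X1))).
apply/funext => l; rewrite /vf_apply big1 // => i _; rewrite /fps_mul big1 // => k _.
rewrite /fps_deriv /fps_mono -mdeg_eq0 mdegD mdeg1 addn1 /=.
by rewrite mul0rn mulr0.
Qed.

(* exp(X) is an algebra automorphism, hence determined by the images of the
   coordinates. *)
Lemma opexp_vf_ext X Y : vf_vanish 1 X -> vf_vanish 1 Y ->
  (forall i, opexp (vf_apply X) (fps_coord R i) = opexp (vf_apply Y) (fps_coord R i)) ->
  opexp (vf_apply X) = opexp (vf_apply Y).
Proof.
move=> X1 Y1 XY; have tX := triangular_vf X1; have tY := triangular_vf Y1.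
have mono d k : mdeg k = d ->
    opexp (vf_apply X) (fps_mono R k) = opexp (vf_apply Y) (fps_mono R k).
  elim: d k => [|d IH] k kd.
    by move/eqP: kd; rewrite mdeg_eq0 => /eqP ->; rewrite !opexp_vf_one.
  have [i ki] : exists i, (0 < k i)%N.
    apply/existsP; apply: contraPT kd; rewrite negb_exists => /forallP k0.
    by rewrite mdegE big1 // => i _; have := k0 i; rewrite lt0n negbK => /eqP.
  have kE : k = mnm_add (mnm1 i) (mnm_sub k (mnm1 i)).
    apply/mnmP => j; rewrite mnmDE mnmBE mnm1E; case: eqP => [<-|_] /=; lia.
  have k'd : mdeg (mnm_sub k (mnm1 i)) = d.
    by move: kd; rewrite [in LHS]kE mdegD mdeg1 add1n => -[].
  rewrite kE -fps_mul_mono !opexp_vfM // (IH _ k'd).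
  by rewrite -[fps_mono R (mnm1 i)]/(fps_coord R i) XY.
apply/funext => g; apply/funext => m; rewrite !(opexpE (d := (mdeg m).+1)) //.
by apply: eq_bigr => k _; rewrite (mono _ _ erefl).
Qed.


(** * Correcting one degree *)

Section LogShift.
Variables (X Xb : fps_tuple R n) (k : nat).
Hypotheses (X1 : vf_vanish 1 X) (Xb1 : vf_vanish 1 Xb) (k_gt0 : (0 < k)%N).
Hypothesis same_exp : opexp (vf_apply X) = opexp (vf_apply Xb).
Let V := X - Xb.
Hypothesis V_small : vf_vanish k.+1 V.

Local Notation D := (vf_apply X).
Local Notation Db := (vf_apply Xb).
Local Notation opp T := (fun g : F => - T g).
Let v j := iter j (vf_bracket X) V.

Let tD : triangular D. Proof. exact: triangular_vf. Qed.
Let tDb : triangular Db. Proof. exact: triangular_vf. Qed.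
Let V1 : vf_vanish 1 V. Proof. exact: vf_vanish_le V_small. Qed.
Let tV : triangular (vf_apply V). Proof. exact: triangular_vf. Qed.
Let tPhi : triangular (opexp D). Proof. exact: triangular_opexp. Qed.

Let vE j : vf_apply (v j) = iter j (twist D (opp D)) (vf_apply V).
Proof. exact: vf_apply_iter_bracket. Qed.

Let gg_v i m : geometric_growth (fun j => v j i m).
Proof. exact: geometric_growth_iter_bracket. Qed.

Let v_small j : vf_vanish k.+1 (v j).
Proof. by elim: j => //= j IH; apply: (@vf_vanish_bracket 0 k). Qed.

(** Each of the two fields commutes with its own exponential, and the exponentials coincide. *)
Let Phi_V g : opexp D (vf_apply V g) = vf_apply V (opexp D g).
Proof.
rewrite !vf_applyBl (triangularD _ _ tPhi) (triangularN _ tPhi).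
by rewrite -opexp_commute // [in RHS]same_exp (opexp_commute g tDb tDb) // -same_exp.
Qed.

Let Phi_v j g : opexp D (vf_apply (v j) g) = vf_apply (v j) (opexp D g).
Proof.
rewrite !vE; elim: j g => [|j IH] g; first exact: Phi_V.
rewrite iterS /twist (triangularD _ _ tPhi) -opexp_commute // IH; congr (_ + _).
by rewrite IH (triangularN _ tPhi) -(opexp_commute g tD tD).
Qed.

(* W is the integral of s exp(s ad X) V over [0, 1]. *)
Let w j : fps_tuple R n := fun i => (j + 1).+1%:R^-1 *: v j i.
Let W : fps_tuple R n := fun i m => expsum (fun j => w j i m).

Let gg_w i m : geometric_growth (fun j => w j i m).
Proof.
have := geometric_growth_div 1 (gg_v i m).
by under eq_fun do rewrite mulrC.
Qed.

Let W_small : vf_vanish k.+1 W.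
Proof.
move=> i m mk; rewrite -[RHS](expsum0 R); congr expsum; apply/funext => j.
by rewrite /w fpsZE v_small // mulr0.
Qed.

Let gg_vf x g m : (forall i l, geometric_growth (fun j => x j i l)) ->
  geometric_growth (fun j => vf_apply (x j) g m).
Proof.
move=> gx; rewrite /vf_apply /fps_mul; apply: geometric_growth_sum => i.
apply: geometric_growth_sum => l; under eq_fun do rewrite mulrC.
exact: geometric_growthZ.
Qed.

Let Phi_W g : opexp D (vf_apply W g) = vf_apply W (opexp D g).
Proof.
apply/funext => m; rewrite [RHS]vf_apply_expsum //.
rewrite [vf_apply W g](_ : _ = fun l => expsum (fun j => vf_apply (w j) g l)).
  rewrite -expsum_triangular //; last by move=> l; exact: gg_vf.
  congr expsum; apply/funext => j.
  by rewrite /w !vf_applyZl (triangularZ _ _ tPhi) Phi_v.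
by apply/funext => l; rewrite vf_apply_expsum.
Qed.

Let v_op i j : v j i = iter j (twist D (opp D)) (vf_apply V) (fps_coord R i).
Proof. by rewrite -vE vf_apply_coord. Qed.

Let expsum_v i m : expsum (fun j => v j i m) = V i m.
Proof.
under eq_fun do rewrite v_op.
rewrite expsum_twist //; last exact: triangular_opp.
by rewrite Phi_V opexp_oppK // vf_apply_coord.
Qed.

Let raise (e : nat) (T : F -> F) : Prop := forall d g, vanish d g -> vanish (e + d) (T g).

Let raise_v j : raise k (vf_apply (v j)).
Proof.
move=> d g vg; apply: vanish_le (vanish_vf (v_small j) vg); lia.
Qed.

(** The derivatives at s = 0 of exp(sX) V exp(-sX'), whereas [v] belongs to exp(sX) V exp(-sX). *)
Let u j := iter j (twist D (opp Db)) (vf_apply V).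

(** Since D = Db + V, each exchange of [Db] for [D] on the right leaves a term v_j V. It contains
    two factors of shift [k], and the triangular operators around it lose nothing. *)
Let raise_uv j : raise (k + k) (fun g => u j g - vf_apply (v j) g).
Proof.
elim: j => [|j IH] d g vg; first by rewrite vE /u /= subrr.
rewrite vE /u !iterS -/(u j) -vE /twist.
rewrite (_ : _ - _ = D (u j g - vf_apply (v j) g) +
  (u j (- Db g) - vf_apply (v j) (- Db g)) + vf_apply (v j) (vf_apply V g)).
  apply: vanishD; last first.
    by apply: vanish_le (@raise_v j _ _ (@raise_v 0 _ _ vg)); lia.
  apply: vanishD; first by apply: tD.2; exact: IH.
  by apply: IH; apply: vanishN; apply: tDb.2.
rewrite (triangularD _ _ tD) (triangularN _ tD) vf_applyBl.
have -> : vf_apply (v j) (D g - Db g) = vf_apply (v j) (- Db g) - vf_apply (v j) (- D g).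
  rewrite -[- D g]scaleN1r vf_applyZ scaleN1r opprK.
  have /triangularD -> : triangular (vf_apply (v j)).
    by apply: triangular_vf; apply: vf_vanish_le (v_small j).
  by rewrite addrC.
rewrite -!addrA; congr (_ + _); rewrite opprD addrCA; congr (_ + _).
by congr (_ + _); rewrite addrA addNr add0r.
Qed.

Let expsum_u i m : expsum (fun j => u j (fps_coord R i) m / j.+1%:R) = 0.
Proof.
(* The derivatives at 0 of exp(tX) exp(-tX') on a coordinate. The first twist sends the identity to
   [V], so [u] is this sequence shifted by one and [expsum_recl] integrates it. *)
pose s j := iter j (twist D (opp Db)) idfun (fps_coord R i) m.
have tb : triangular (opp Db) by exact: triangular_opp.
have gs : geometric_growth s.
  exact: (geometric_growth_twist _ _ tD tb (triangular_id R n)).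
have sS j : s j.+1 = u j (fps_coord R i) m.
  rewrite /s /u iterSr; congr (iter j _ _ _ _); apply/funext => g.
  by rewrite /twist /= vf_applyBl.
have := expsum_recl gs; rewrite (expsum_twist _ _ tD tb (triangular_id R n)) /=.
rewrite same_exp opexp_oppK // -[s 0%N]/(fps_coord R i m) => /eqP.
rewrite -subr_eq0 opprD addrA subrr add0r oppr_eq0 => /eqP s0.
rewrite -[RHS]s0; by congr expsum; apply/funext => j; rewrite sS.
Qed.

Let bracket_W : vf_vanish k.+2 (vf_bracket X W - V).
Proof.
move=> i m mk; rewrite -[LHS]/(vf_bracket X W i m - V i m).
have gd := geometric_growth_div 0 (gg_v i m).
(* Integration by parts, term by term: the bracket has the terms v_(j+1) / (j+2), and (1 - 1/(j+2))
   / (j+1) = 1/(j+2). The term of index 0 on the right is 0. *)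
have -> : vf_bracket X W i m = expsum (fun j => v j i m - v j i m / (j + 0).+1%:R).
  rewrite expsum_recl; last first.
    apply: geometric_growthD => //; apply: geometric_growth_le gd _ => j.
    by rewrite normrN.
  rewrite divr1 subrr add0r /vf_bracket fpsBE.
  rewrite -expsum_triangular // vf_apply_expsum // -expsumB; last 2 first.
  - exact: geometric_growth_triangular.
  - exact: gg_vf.
  congr expsum; apply/funext => j.
  rewrite /w vf_applyZ vf_applyZl !fpsZE -mulrBr.
  rewrite -[X in _ * X]/(v j.+1 i m) addn0 addn1.
  have j1 : j.+1%:R != 0 :> C by rewrite pnatr_eq0.
  have j2 : j.+1%:R + 1 != 0 :> C by rewrite natr1 pnatr_eq0.
  rewrite -[j.+2%:R]natr1; move: (j.+1%:R) j1 j2 => a a0 a1.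
  by field; rewrite a0 a1.
rewrite expsumB // expsum_v -[V i m in LHS]addr0 addrAC subrr add0r.
rewrite (_ : expsum _ = 0) ?oppr0 // -(expsum_u i m); congr expsum; apply/funext => j.
rewrite addn0; congr (_ / _); apply/eqP; rewrite eq_sym -subr_eq0; apply/eqP.
have coord1 : vanish 1 (fps_coord R i : F).
  move=> l; rewrite ltnS leqn0 mdeg_eq0 => /eqP ->; rewrite /fps_coord.
  by rewrite eq_sym -mdeg_eq0 mdeg1.
(* A coordinate has order 1, so the difference has order 2k + 1, which is at least k + 2 because [k]
   is positive. *)
rewrite v_op -vE; apply: (@raise_uv j _ _ coord1 m); lia.
Qed.

Let cW : fps_tuple R n := fun i => 2%:R^-1 *: W i.
Let x j := iter j (vf_bracket cW) X.
(** The field exp(ad W/2) X, which acts as the conjugate of [X] by exp(W/2). *)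
Let Y : fps_tuple R n := fun i m => expsum (fun j => x j i m).

Let cW_small : vf_vanish k.+1 cW.
Proof. by move=> i m mk; rewrite /cW fpsZE W_small // mulr0. Qed.

Let cW1 : vf_vanish 1 cW. Proof. exact: vf_vanish_le cW_small. Qed.

Let x_small j : vf_vanish k.+1 (x j.+1).
Proof.
elim: j => [|j IH]; first by apply: vf_vanish_le (vf_vanish_bracket cW_small X1); lia.
by apply: vf_vanish_le (vf_vanish_bracket cW_small IH); lia.
Qed.

Let gg_x i m : geometric_growth (fun j => x j i m).
Proof. exact: geometric_growth_iter_bracket. Qed.

Let Y1 : vf_vanish 1 Y.
Proof.
move=> i m m1; rewrite -[RHS](expsum0 R); congr expsum; apply/funext => j.
by case: j => [|j]; [exact: X1|by apply: (vf_vanish_le (ltn0Sn k) (x_small j))].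
Qed.

Local Notation N := (vf_apply cW).

Let vf_applyY g : vf_apply Y g = opexp N (D (opexp (opp N) g)).
Proof.
have tN := triangular_vf cW1.
apply/funext => m; rewrite vf_apply_expsum // -expsum_twist //; last first.
  exact: triangular_opp.
by congr expsum; apply/funext => j; rewrite /x vf_apply_iter_bracket.
Qed.

(** Conjugation passes to all iterates, hence to the exponential; exp(D) is then unchanged because
    it commutes with [W], and so with exp(W/2). *)
Let opexp_Y : opexp (vf_apply Y) = opexp D.
Proof.
have tN := triangular_vf cW1; have tN' := triangular_opp tN.
have NK g : opexp (opp N) (opexp N g) = g.
  have /= := opexp_oppK g tN'.
  by rewrite (_ : (fun h : F => - - N h) = N) //; apply/funext => h; exact: opprK.
have iterY j g : iter j (vf_apply Y) g = opexp N (iter j D (opexp (opp N) g)).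
  elim: j => [|j IH]; first by rewrite /= opexp_oppK.
  by rewrite iterS IH vf_applyY NK.
apply/funext => g; apply/funext => m; rewrite {1}/opexp.
under eq_fun do rewrite iterY.
rewrite expsum_triangular; last 2 first.
- exact: triangular_opexp.
- by move=> l; exact: geometric_growth_iter.
rewrite -[fun l => expsum _]/(opexp D (opexp (opp N) g)) -opexp_commute //.
  by rewrite opexp_oppK.
by move=> h; rewrite /cW !vf_applyZl (triangularZ _ _ tPhi) Phi_W.
Qed.

Let Y_leading : vf_vanish k.+2 (fun i => Y i - (X i - 2%:R^-1 *: V i)).
Proof.
move=> i m mk; have gx := gg_x i m; have gx' := geometric_growthS gx.
have gd : geometric_growth (fun j => x j.+1 i m / j.+1%:R).
  by have := geometric_growth_div 0 gx'; under eq_fun do rewrite addn0.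
(* Splits off X and [W/2, X]. The remaining terms contain at least two brackets with W/2, hence have
   order at least 2k + 1 >= k + 2. *)
rewrite fpsBE -[Y i m]/(expsum _) expsum_recl // expsum_recl //.
rewrite (_ : expsum _ = 0); last first.
  rewrite -[RHS](expsum0 R); congr expsum; apply/funext => j.
  rewrite [x _ i m](_ : _ = 0) ?mul0r //.
  by apply: (vf_vanish_le (d := k.+2) _ (vf_vanish_bracket cW_small (x_small j))) => //; lia.
rewrite addr0 divr1 fpsBE fpsZE opprB addrCA addrA -[x 0 i m]/(X i m).
have -> : x 1 i m = - (2%:R^-1 * vf_bracket X W i m).
  rewrite /x /= /vf_bracket !fpsBE /cW vf_applyZl vf_applyZ !fpsZE -mulrBr.
  by rewrite -mulrN opprB.
have /eqP : vf_bracket X W i m - V i m = 0 := @bracket_W i m mk.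
rewrite subr_eq0 => /eqP ->.
ring.
Qed.

Lemma log_shift_exists : exists Y : fps_tuple R n,
  [/\ vf_vanish 1 Y, opexp (vf_apply Y) = opexp (vf_apply X) &
      vf_vanish k.+2 (fun i => Y i - (X i - 2%:R^-1 *: (X i - Xb i)))].
Proof. by exists Y; split; [exact: Y1|exact: opexp_Y|exact: Y_leading]. Qed.

End LogShift.
End VectorFields.

(** * Real logarithms *)

Section Realification.
Variables (R : realType) (n : nat).
Local Notation C := R[i].
Local Notation F := (fps R n).
Implicit Types (g h : F) (X Y : fps_tuple R n).

Lemma vf_expE X : vf_exp X = fun i => opexp (vf_apply X) (fps_coord R i).
Proof. by []. Qed.

(** * Complex conjugation of fields and of their exponentials *)

Lemma conjc_fixP (z : C) : reflect (z^*%C = z) (z \is Num.real).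
Proof.
case: z => a b; rewrite complex_real; apply: (iffP eqP) => [->|[/eqP]] /=.
  by rewrite oppr0.
by rewrite eq_sym -addr_eq0 -mulr2n mulrn_eq0 => /eqP.
Qed.

Definition fps_conj g : F := fun m => (g m)^*%C.
Definition vf_conj X : fps_tuple R n := fun i => fps_conj (X i).

Lemma vf_apply_conj X g : vf_apply (vf_conj X) (fps_conj g) = fps_conj (vf_apply X g).
Proof.
apply/funext => m; rewrite /fps_conj /vf_apply rmorph_sum; apply: eq_bigr => j _.
rewrite /fps_mul rmorph_sum; apply: eq_bigr => k _.
by rewrite rmorphM /fps_deriv rmorphMn.
Qed.

Lemma vf_conj_vanish d X : vf_vanish d X -> vf_vanish d (vf_conj X).
Proof. by move=> vX i m md; rewrite /vf_conj /fps_conj vX // conjc0. Qed.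

Lemma vf_exp_conj X : vf_vanish 1 X -> vf_exp (vf_conj X) = vf_conj (vf_exp X).
Proof.
move=> X1; apply/funext => i; apply/funext => m.
rewrite /vf_conj /fps_conj !vf_expE /opexp -expsum_conj; last first.
  exact/geometric_growth_iter/triangular_vf.
congr expsum; apply/funext => j.
have coordE : fps_coord R i = fps_conj (fps_coord R i).
  by apply/funext => l; rewrite /fps_conj /fps_coord conjc_nat.
rewrite {1}coordE -[RHS]/(fps_conj _ m); congr (_ m).
by elim: j => //= j ->; exact: vf_apply_conj.
Qed.

(** Below degree [d] the exponential sees only the coefficients of the field below degree [d]. Hence
    a limit of logarithms that stabilise degree by degree is again a logarithm. *)
Lemma opexp_vf_local d X Y g : vf_vanish 1 Y -> vf_vanish d (X - Y) ->
  vanish d (opexp (vf_apply X) g - opexp (vf_apply Y) g).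
Proof.
move=> Y1 XY m md; rewrite fpsBE; apply/eqP; rewrite subr_eq0; apply/eqP.
congr expsum; apply/funext => j; apply/eqP; rewrite -subr_eq0; apply/eqP.
suff : vanish d (iter j (vf_apply X) g - iter j (vf_apply Y) g) by apply.
elim: j => [|j IH]; first by rewrite subrr.
rewrite !iterS; set a := iter j (vf_apply X) g; set b := iter j (vf_apply Y) g.
have tY := triangular_vf Y1.
rewrite (_ : _ - _ = vf_apply (X - Y) a + vf_apply Y (a - b)).
  apply: vanishD; last exact: tY.2.
  by apply: vanish_le (vanish_vf XY (@vanish0 _ _ a)); rewrite addn0.
by rewrite vf_applyBl (triangularD _ _ tY) (triangularN _ tY) addrA subrK.
Qed.

Section Limit.
Variable phi : fps_tuple R n.
Hypothesis phi_real : forall i, real_fps (phi i).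

(** The bound [k.+2] means degree at most k + 1, so that stage 0 asks for a real linear part. *)
Definition real_log_upto (k : nat) X : Prop :=
  [/\ vf_vanish 1 X, phi = vf_exp X & forall i m, (mdeg m < k.+2)%N -> X i m \is Num.real].

Lemma real_log_step k X : real_log_upto k X ->
  exists2 Y, real_log_upto k.+1 Y & forall i m, (mdeg m < k.+2)%N -> Y i m = X i m.
Proof.
move=> [X1 phiX X_real]; have Xc1 := vf_conj_vanish X1.
have phiXc : phi = vf_exp (vf_conj X).
  rewrite vf_exp_conj // -phiX; apply/funext => i; apply/funext => m.
  exact/esym/conjc_fixP/phi_real.
have same_exp : opexp (vf_apply X) = opexp (vf_apply (vf_conj X)).
  apply: opexp_vf_ext => // i.
  by rewrite -[LHS]/(vf_exp X i) -[RHS]/(vf_exp (vf_conj X) i) -phiX -phiXc.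
have small : vf_vanish k.+2 (X - vf_conj X).
  move=> i m mk; rewrite -[LHS]/(X i m - (X i m)^*%C).
  by have /conjc_fixP -> := X_real i m mk; rewrite subrr.
(* The correction is applied with [k.+1], which is positive already at stage 0. *)
have [Y [Y1 expY YX]] := log_shift_exists X1 Xc1 (ltn0Sn k) same_exp small.
have YE i m : (mdeg m < k.+3)%N -> Y i m = X i m - 2%:R^-1 * (X i m - (X i m)^*%C).
  by move=> mk; apply/eqP; rewrite -subr_eq0; apply/eqP; exact: YX.
exists Y => [|i m mk]; last first.
  have /conjc_fixP Xr := X_real i m mk.
  by rewrite YE ?Xr ?subrr ?mulr0 ?subr0 // ltnW.
split=> // [|i m mk]; first by rewrite vf_expE expY -vf_expE.
rewrite YE // (_ : _ - _ = (complex.Re (X i m))%:C%C) ?complex_real ?eqxx //.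
by rewrite ReJ_add; field.
Qed.

Lemma real_log_exists X : real_log_upto 0 X ->
  exists Y, [/\ real_formal_vector_field Y, phi = vf_exp Y & jet1 Y = jet1 X].
Proof.
move=> X0.
have /choice[f fP] (kX : nat * fps_tuple R n) : exists Y,
    real_log_upto kX.1 kX.2 -> real_log_upto kX.1.+1 Y /\
      forall i m, (mdeg m < kX.1.+2)%N -> Y i m = kX.2 i m.
  case: kX => k Z /=; have [/real_log_step[Y]|nZ] := pselect (real_log_upto k Z).
    by exists Y.
  (* An arbitrary value outside the domain of the step; the sequence [Xs] stays inside it. *)
  by exists Z => /nZ.
pose Xs := fix Xs k := if k is k'.+1 then f (k', Xs k') else X.
have XsP k : real_log_upto k (Xs k).
  by elim: k => //= k IH; exact: (fP (k, Xs k) IH).1.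
have Xs_stable k l i m : (k <= l)%N -> (mdeg m < k.+2)%N -> Xs l i m = Xs k i m.
  move=> kl mk; rewrite -(subnK kl); elim: (l - k)%N => //= j <-.
  by apply: (fP (_, _) (XsP (j + k)%N)).2; apply: leq_trans mk _; rewrite !ltnS leq_addl.
(* Stage k fixes all degrees up to k + 1, so the coefficient at [m] is final by stage [mdeg m] and
   the diagonal is the limit. *)
pose Y : fps_tuple R n := fun i m => Xs (mdeg m) i m.
have Y1 : vf_vanish 1 Y by move=> i m m1; case: (XsP (mdeg m)) => + _ _; apply.
exists Y; split.
- split=> [|i m]; first exact/formal_vector_fieldE.
  by have [_ _] := XsP (mdeg m); apply.
- apply/funext => i; apply/funext => m; have [Z1 phiZ _] := XsP (mdeg m).
  have small : vf_vanish (mdeg m).+1 (Y - Xs (mdeg m)).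
    move=> j l lm; rewrite -[LHS]/(Xs (mdeg l) j l - Xs (mdeg m) j l).
    by rewrite (Xs_stable (mdeg l) (mdeg m)) ?subrr.
  have /(_ m (ltnSn _))/eqP := opexp_vf_local (fps_coord R i) Z1 small.
  by rewrite fpsBE subr_eq0 => /eqP E; rewrite [in LHS]phiZ; exact: esym E.
- apply/funext => i; apply/funext => m; rewrite /jet1; case: leqP => // m1.
  by rewrite /Y (Xs_stable 0%N).
Qed.

End Limit.
End Realification.

Theorem theorem1p3 (R : realType) (n : nat) (phi X : fps_tuple R n) :
  (1 <= n)%N ->
  real_formal_diffeo phi ->
  formal_vector_field X ->
  phi = vf_exp X ->
  real_analytic_vector_field (jet1 X) ->
  exists Y : fps_tuple R n,
    [/\ real_formal_vector_field Y, phi = vf_exp Y & jet1 Y = jet1 X].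
Proof.
move=> _ [_ phi_real] /formal_vector_fieldE X1 phiX [[_ jet_real] _].
apply: real_log_exists => //; split=> // i m m1.
by have := jet_real i m; rewrite /jet1 -ltnS m1.
Qed.
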